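(* Let $K\subset\mathbb{R}^n$ be a convex body, and let $L,C\subset K$ be compact bodies (possibly not connected) with $K=L\cup C$, $\mathrm{int}\,L\cap\mathrm{int}\,C=\emptyset$, and $L$ isotropic. Then $$\frac{1}{\mathcal{C}(K)}=\frac{\det\left(\mathcal{C}(L)^{-\frac1n}I_n+|C|\,\mathrm{Cov}(C)+\frac{|C|}{|K|}\,b(C)b(C)^T\right)}{|K|^{n+2}}.$$
   Context: A convex body is a compact convex set with nonempty interior. A compact body is a compact set with nonempty interior, not necessarily convex or connected, whose boundary has Lebesgue measure zero. $|\cdot|$ is Lebesgue measure. For a compact body $A\subset\mathbb{R}^n$: the barycenter is the column vector $b(A)=\int_A x\frac{dx}{|A|}$; the covariance matrix is $\mathrm{Cov}(A)_{ij}=\int_A x_ix_j\frac{dx}{|A|}-\int_A x_i\frac{dx}{|A|}\int_A x_j\frac{dx}{|A|}$; and $\mathcal{C}(A)=\frac{|A|^2}{\det\mathrm{Cov}(A)}$. $A$ is isotropic (in isotropic position) if $|A|=1$, $b(A)=0$ and $\mathrm{Cov}(A)$ is a multiple of the identity. $I_n$ is the $n\times n$ identity matrix. *)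

(* Defs.v *)
From HB Require Import structures.
From mathcomp Require Import all_boot all_order all_algebra.
From mathcomp Require Import all_classical all_reals all_analysis.
From mathcomp Require Import measurable_realfun.

Set Implicit Arguments.
Unset Strict Implicit.
Unset Printing Implicit Defensive.

Import Order.TTheory GRing.Theory Num.Theory.
Import numFieldNormedType.Exports.

Local Open Scope classical_set_scope.
Local Open Scope ring_scope.

Section borel_matrix.
Context {R : realType} {m n : nat}.

(* [open] refers to the product topology on entries *)
Let borel : set (set 'M[R]_(m, n)) := <<s open >>.

Let borel0 : borel set0.
Proof. exact: sigma_algebra0. Qed.

Let borelC A : borel A -> borel (~` A).
Proof. exact: sigma_algebraC. Qed.

Let borel_bigcup (F : (set 'M[R]_(m, n))^nat) :
  (forall i, borel (F i)) -> borel (\bigcup_i F i).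
Proof. exact: sigma_algebra_bigcup. Qed.

HB.instance Definition _ := @isMeasurable.Build default_measure_display
  'M[R]_(m, n) borel borel0 borelC borel_bigcup.

End borel_matrix.

Section borel_matrix_lemmas.
Context {R : realType} {m n : nat}.

Lemma open_measurable_mx (A : set 'M[R]_(m, n)) : open A -> measurable A.
Proof. exact: sub_sigma_algebra. Qed.

Lemma closed_measurable_mx (A : set 'M[R]_(m, n)) : closed A -> measurable A.
Proof.
by move=> /closed_openC/open_measurable_mx/measurableC; rewrite setCK.
Qed.

Lemma measurable_coord (i : 'I_m) (j : 'I_n) :
  measurable_fun setT (fun M : 'M[R]_(m, n) => M i j).
Proof.
apply: (measurability _ (RGenOpens.measurableE R)).
move=> _ [_ [a [b ->] <-]]; rewrite setTI; apply: open_measurable_mx.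
move: (@coord_continuous R m n i j) => /continuousP; apply.
exact: interval_open.
Qed.

Lemma measurable_fun_mx d (T : measurableType d) (f : T -> 'M[R]_(m, n)) :
  (forall i j, measurable_fun setT (fun x => f x i j)) -> measurable_fun setT f.
Proof.
move=> mf; apply: (measurability (@open 'M[R]_(m, n))) => //.
move=> _ [U oU <-]; rewrite setTI.
pose box (q : {ffun 'I_m * 'I_n -> rat * rat}) : set 'M[R]_(m, n) :=
  [set M | forall i j,
    M i j \in `](ratr (q (i, j)).1 : R), (ratr (q (i, j)).2 : R)[].
have -> : U = \bigcup_q (if `[<box q `<=` U>] then box q else set0).
  apply/seteqP; split => [M UM|M [q _]]; last first.
    by case: ifPn => // /asboolP qU /qU.
  have /nbhs_ballP[e /= e0 eU] : nbhs M U by exact: open_nbhs_nbhs.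
  have /choice[q Hq] : forall ij : 'I_m * 'I_n, exists q : rat * rat,
      [/\ M ij.1 ij.2 \in `](ratr q.1 : R), (ratr q.2 : R)[,
       M ij.1 ij.2 - e < ratr q.1 & ratr q.2 < M ij.1 ij.2 + e].
    move=> [i j] /=.
    have [q1 q1P] := @rat_in_itvoo R (M i j - e) (M i j)
      ltac:(by rewrite ltrBlDr ltrDl).
    have [q2 q2P] := @rat_in_itvoo R (M i j) (M i j + e)
      ltac:(by rewrite ltrDl).
    move: q1P q2P; rewrite !in_itv/= => /andP[? ?] /andP[? ?].
    by exists (q1, q2); split => //=; rewrite in_itv/=; apply/andP; split.
  exists [ffun ij => q ij] => //; rewrite ifT; last first.
    apply/asboolP => N boxN; apply: eU; split => // i j.
    have := boxN i j; rewrite ffunE in_itv /= => /andP[N1 N2].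
    have [_ M1 M2] := Hq (i, j); rewrite /ball /= distrC ltr_distl.
    by rewrite (lt_trans M1 N1) (lt_trans N2 M2).
  by move=> i j; rewrite ffunE; have [] := Hq (i, j).
rewrite preimage_bigcup; apply: countable_bigcupT_measurable => //.
move=> q; case: ifPn => _; last by rewrite preimage_set0.
rewrite (_ : _ @^-1` _ = \bigcap_(ij in [set: 'I_m * 'I_n])
    ((fun x => f x ij.1 ij.2) @^-1`
     `](ratr (q ij).1 : R), (ratr (q ij).2 : R)[%classic)); last first.
  apply/seteqP; split => [x fx [i j] _ /=|x fx i j]; first exact: fx.
  exact: (fx (i, j) I).
apply: fin_bigcap_measurable => // ij _.
rewrite -[X in measurable X]setTI; apply: mf => //.
Qed.
End borel_matrix_lemmas.

(* [lebesgue_cV] is the n-dimensional Lebesgue measure on Borel sets: the n-fold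
   product of the one-dimensional measure, transported along R * R^n = R^n.+1
   (R^0 is a single point, of measure 1). See [lebesgue_cV_box]. *)
Section lebesgue_cV.
Context {R : realType}.

Definition cV_cons n (p : measurableTypeR R * 'cV[R]_n) : 'cV[R]_n.+1 :=
  col_mx (p.1 : R)%:M p.2.

Fixpoint lebesgue_cV n : set 'cV[R]_n -> \bar R :=
  match n with
  | 0 => \d_(0 : 'cV[R]_0)
  | n'.+1 => pushforward (lebesgue_measure \x @lebesgue_cV n')%E (@cV_cons n')
  end.

Lemma cV_cons_head n p j : @cV_cons n p (@lshift 1 n 0) j = p.1.
Proof. by apply: etrans (col_mxEu _ _ _ _) _; rewrite ord1 mxE. Qed.

Lemma cV_cons_tail n p i j : @cV_cons n p (rshift 1 i) j = p.2 i j.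
Proof. exact: col_mxEd. Qed.

Let cV_split n (v : 'cV[R]_n.+1) : measurableTypeR R * 'cV[R]_n :=
  (v 0 0, dsubmx (v : 'cV[R]_(1 + n))).

Let cV_consK n : cancel (@cV_cons n) (@cV_split n).
Proof.
move=> [x v]; congr (_, _); last exact: col_mxKd.
by rewrite (_ : 0 = @lshift 1 n 0) ?cV_cons_head//; exact/val_inj.
Qed.

Lemma measurable_cV_cons n : measurable_fun setT (@cV_cons n).
Proof.
apply: measurable_fun_mx => i j; rewrite ord1.
have [k ->|k ->] := @split_ordP 1 n i.
  rewrite ord1 (_ : (fun _ => _) = fst)//.
  by apply/funext => x; rewrite cV_cons_head.
rewrite (_ : (fun _ => _) = (fun v : 'cV[R]_n => v k 0) \o snd).
  by apply: measurableT_comp => //; exact: measurable_coord.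
by apply/funext => x /=; rewrite cV_cons_tail.
Qed.

Let measurable_cV_split n : measurable_fun setT (@cV_split n).
Proof.
apply: measurable_fun_pair; first exact: measurable_coord.
apply: measurable_fun_mx => i j.
rewrite (_ : (fun _ => _) = fun v : 'cV[R]_n.+1 => v (rshift 1 i) j).
  exact: measurable_coord.
by apply/funext => v; rewrite mxE.
Qed.

Let sigma_finite_measureP d (T : measurableType d) (nu : set T -> \bar R) :
  nu set0 = 0%E -> (forall A, 0 <= nu A)%E -> semi_sigma_additive nu ->
  sigma_finite setT nu ->
  exists mu : {sigma_finite_measure set T -> \bar R}, nu = mu.
Proof.
move=> nu0 nu_ge0 nu_sa nu_sf.
pose m1 := isMeasure.Build _ _ _ nu nu0 nu_ge0 nu_sa.
pose nu1 : {measure set T -> \bar R} := HB.pack nu m1.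
pose m2 := Measure_isSigmaFinite.Build _ _ _ nu1 nu_sf.
pose nu2 : {sigma_finite_measure set T -> \bar R} := HB.pack nu m1 m2.
by exists nu2.
Qed.

Let lebesgue_cVP n :
  exists mu : {sigma_finite_measure set 'cV[R]_n -> \bar R},
    @lebesgue_cV n = mu.
Proof.
elim: n => [|n [mu muE]].
  by exists (\d_(0 : 'cV[R]_0)).
pose nu := pushforward (lebesgue_measure \x mu)%E (@cV_cons n).
have mc := @measurable_cV_cons n.
have nu0 : nu set0 = 0%E by exact: measure0.
have nu_ge0 A : (0 <= nu A)%E by exact: measure_ge0.
have nu_sa : semi_sigma_additive nu by exact: measure_semi_sigma_additive.
have nu_sf : sigma_finite setT nu.
  have /sigma_finiteP[F [TF ndF Foo]] :=
    sigma_finiteT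
      (@lebesgue_measure R : {sigma_finite_measure set _ -> \bar R}).
  have /sigma_finiteP[G [TG ndG Goo]] := sigma_finiteT mu.
  exists (fun k => @cV_split n @^-1` (F k `*` G k)) => [|k].
    apply/esym/seteqP; split => // v _.
    have [i _ Fi] : (\bigcup_i F i) (cV_split v).1 by rewrite -TF.
    have [j _ Gj] : (\bigcup_i G i) (cV_split v).2 by rewrite -TG.
    exists (maxn i j) => //; split.
      by move: Fi; exact/subsetPset/ndF/leq_maxl.
    by move: Gj; exact/subsetPset/ndG/leq_maxr.
  have [mF Fk] := Foo k; have [mG Gk] := Goo k.
  have mFG := measurableX mF mG; split.
    by rewrite -[X in measurable X]setTI; exact: measurable_cV_split.
  rewrite /nu /pushforward -comp_preimage (_ : _ \o _ = id); last first.
    by apply/funext => x /=; rewrite cV_consK.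
  by rewrite preimage_id product_measure1E// lte_mul_pinfty// ge0_fin_numE.
have [nu' nu'E] := sigma_finite_measureP nu0 nu_ge0 nu_sa nu_sf.
by exists nu'; rewrite /= muE.
Qed.

Variable n : nat.

Let lebesgue_cV0 : @lebesgue_cV n set0 = 0%E.
Proof. by have [mu ->] := lebesgue_cVP n. Qed.

Let lebesgue_cV_ge0 A : (0 <= @lebesgue_cV n A)%E.
Proof. by have [mu ->] := lebesgue_cVP n. Qed.

Let lebesgue_cV_sigma_additive : semi_sigma_additive (@lebesgue_cV n).
Proof.
by have [mu ->] := lebesgue_cVP n; exact: measure_semi_sigma_additive.
Qed.

HB.instance Definition _ := isMeasure.Build _ _ _ (@lebesgue_cV n)
  lebesgue_cV0 lebesgue_cV_ge0 lebesgue_cV_sigma_additive.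

Let lebesgue_cV_sigma_finite : sigma_finite setT (@lebesgue_cV n).
Proof. by have [mu ->] := lebesgue_cVP n; exact: sigma_finiteT. Qed.

HB.instance Definition _ := Measure_isSigmaFinite.Build _ _ _ (@lebesgue_cV n)
  lebesgue_cV_sigma_finite.

End lebesgue_cV.
Arguments lebesgue_cV {R n}.

Lemma lebesgue_cV_box (R : realType) n (I : 'I_n -> interval R) :
  lebesgue_cV [set x : 'cV[R]_n | forall i, x i 0 \in I i] =
  (\prod_(i < n) lebesgue_measure [set` I i])%E.
Proof.
elim: n I => [|n IH] I.
  by rewrite big_ord0 /= diracE mem_set// => -[].
rewrite big_ord_recl -IH /= /pushforward.
rewrite -product_measure1E//; last first.
  rewrite (_ : mkset _ = \bigcap_(i in [set: 'I_n])
      ((fun x : 'cV[R]_n => x i 0) @^-1` [set` I (lift ord0 i)])); last first.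
    by apply/seteqP; split=> x /= H i; [move=> _|]; exact: H.
  apply: fin_bigcap_measurable => // i _.
  rewrite -[X in measurable X]setTI; apply: measurable_coord => //.
congr product_measure1; apply/seteqP; split => -[x v] /=.
    move=> H; split=> [|i].
    have := H (@lshift 1 n 0); rewrite cV_cons_head.
    by congr (_ \in I _); exact/val_inj.
  have := H (rshift 1 i); rewrite cV_cons_tail.
  by congr (_ \in I _); exact/val_inj.
move=> [xI vI] i; have [k ->|k ->] := @split_ordP 1 n i.
  by rewrite ord1 cV_cons_head; move: xI; congr (_ \in I _); exact/val_inj.
by rewrite cV_cons_tail; move: (vI k); congr (_ \in I _); exact/val_inj.
Qed.

Section bodies.
Context {R : realType} {n : nat}.
Implicit Type A : set 'cV[R]_n.

Definition convex_body A :=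
  [/\ compact A, @convex_set R 'cV[R]_n A & A° !=set0].

Definition boundary A := closure A `\` A°.

Definition compact_body A :=
  [/\ compact A, A° !=set0 & lebesgue_cV (boundary A) = 0%E].

Definition volume A : R := fine (lebesgue_cV A).

(* integral of f against dx/|A| *)
Definition mean A (f : 'cV[R]_n -> R) : R :=
  (\int[lebesgue_cV]_(x in A) f x) / volume A.

Definition barycenter A : 'cV[R]_n := \col_i mean A (fun x => x i 0).

Definition Cov A : 'M[R]_n := \matrix_(i, j)
  (mean A (fun x => x i 0 * x j 0)
   - mean A (fun x => x i 0) * mean A (fun x => x j 0)).

(* The paper's calligraphic C(A) *)
Definition calC A : R := volume A ^+ 2 / \det (Cov A).

Definition isotropic A :=
  [/\ volume A = 1, barycenter A = 0 & exists c : R, Cov A = c%:M].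

End bodies.

(* Main.v *)
Require Import Defs.
From mathcomp Require Import all_boot all_order all_algebra.
From mathcomp Require Import all_classical all_reals all_analysis.
From mathcomp Require Import measurable_realfun ring.
Import Order.TTheory GRing.Theory Num.Theory.
Import numFieldNormedType.Exports.
Local Open Scope classical_set_scope.
Local Open Scope ring_scope.

(** The formula is the parallel-axis computation for moments. Two compact
    bodies with disjoint interiors meet only inside their boundaries
    ([compact_body_overlap]), so the integral over K of a continuous function
    is the sum of its integrals over L and C ([Rintegral_setU_overlap]).
    Applied to the functions 1, x_i and x_i x_j, with L isotropic and
    Cov(L) = c I, this gives |K| = 1 + |C|, |K| b(K) = |C| b(C) and
      |K| E_K[x x^T] = c I + |C| (Cov(C) + b(C) b(C)^T).
    Subtracting |K| b(K) b(K)^T = (|C|^2 / |K|) b(C) b(C)^T leaves the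
    coefficient |C| - |C|^2 / |K| = |C| / |K| on b(C) b(C)^T, since
    |K| - |C| = 1. Hence
      |K| Cov(K) = c I + |C| Cov(C) + (|C| / |K|) b(C) b(C)^T.
    Moreover C(L) = 1 / c^n, so c = C(L)^(-1/n) ([powR_exprVK]), and taking
    determinants, where |K| comes out as |K|^n, gives the statement. *)

Lemma compact_measurable_cV (R : realType) (n : nat) (A : set 'cV[R]_n) :
  compact A -> measurable A.
Proof.
move=> cA; apply: closed_measurable_mx.
exact: compact_closed (@norm_hausdorff R 'cV[R]_n) cA.
Qed.

(** A compact set is bounded, hence lies in a cube, whose measure is a finite
    product of edge lengths. *)
Lemma compact_lebesgue_cV_fin (R : realType) (n : nat) (A : set 'cV[R]_n) :
  compact A -> (lebesgue_cV A < +oo)%E.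
Proof.
move=> cA; have [M [_ MA]] := compact_bounded cA.
(* The absolute value makes B positive, so that `[- B, B] is nondegenerate. *)
pose B := `|M| + 1.
have B0 : 0 < B by rewrite ltr_wpDl.
have {MA} AB : forall x, A x -> `|x| <= B.
  by apply: MA; rewrite /B (le_lt_trans (ler_norm M))// ltrDl.
pose I (i : 'I_n) : interval R := `[- B, B].
suff /le_lt_trans : (lebesgue_cV A <=
    lebesgue_cV [set x : 'cV[R]_n | forall i, x i ord0 \in I i])%E.
  apply; rewrite lebesgue_cV_box (eq_bigr (fun=> (B - - B)%:E)).
    by rewrite prodEFin ltry.
  move=> i _; rewrite lebesgue_measure_itv /= lte_fin.
  by rewrite (lt_trans _ B0)// oppr_lt0.
apply: le_measure; rewrite ?inE.
- exact: compact_measurable_cV.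
- have -> : [set x : 'cV[R]_n | forall i, x i ord0 \in I i] =
    \bigcap_(i in [set: 'I_n])
      (setT `&` (fun x : 'cV[R]_n => x i ord0) @^-1` [set` I i]).
    apply/seteqP; split => [x xI i _|x xI i]; first by split => //; exact: xI.
    by have [] := xI i Logic.I.
  by apply: fin_bigcap_measurable => // i _; exact: measurable_coord.
- move=> x /AB xB i; rewrite /= in_itv /= -ler_norml.
  (* The norm of a column is the maximum of the absolute entries. *)
  apply: le_trans xB; rewrite {2}/Num.norm /= mx_normrE.
  exact: (le_bigmax _ (fun ij : 'I_n * 'I_1 => `|x ij.1 ij.2|) (i, ord0)).
Qed.

Lemma continuous_compact_integrable_cV (R : realType) (n : nat)
    (A : set 'cV[R]_n) (f : 'cV[R]_n -> R) :
  compact A -> continuous f -> lebesgue_cV.-integrable A (EFin \o f).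
Proof.
move=> cA cf; apply: measurable_bounded_integrable.
- exact: compact_measurable_cV.
- exact: compact_lebesgue_cV_fin.
- apply: (@measurable_funS _ _ _ _ setT) => //.
  apply: (measurability _ (RGenOpens.measurableE R)).
  move=> _ [_ [a [b ->] <-]]; rewrite setTI; apply: open_measurable_mx.
  by move/continuousP : cf; apply; exact: interval_open.
- have /compact_bounded[M [Mr MA]] : compact (f @` A).
    by apply: continuous_compact => //; exact: continuous_subspaceT.
  exists M; split => // y /MA {}MA x Ax /=.
  by apply: MA; exists x.
Qed.

(** A point of both bodies cannot be interior to both, so it is a boundary
    point of one of them, and both boundaries are null. *)
Lemma compact_body_overlap (R : realType) (n : nat) (A B : set 'cV[R]_n) :
  compact_body A -> compact_body B -> A° `&` B° = set0 ->
  lebesgue_cV (A `&` B) = 0%E.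
Proof.
have bd (D : set 'cV[R]_n) :
    compact_body D -> D = closure D /\ measurable (boundary D).
  move=> [cD _ _].
  have clD : closed D := compact_closed (@norm_hausdorff R 'cV[R]_n) cD.
  split; first exact/closure_id.
  apply: measurableD.
    by apply: closed_measurable_mx; exact: closed_closure.
  by apply: open_measurable_mx; exact: open_interior.
move=> bA bB AB; have [clA mA] := bd _ bA; have [clB mB] := bd _ bB.
have [cA _ _] := bA; have [cB _ _] := bB.
apply: (@subset_measure0 _ _ _ _ _ (boundary A `|` boundary B)).
- by apply: measurableI; exact: compact_measurable_cV.
- exact: measurableU.
- move=> x [Ax Bx]; have [Aox|] := pselect (A° x); last first.
    by move=> nAox; left; split => //; rewrite -clA.
  right; split; first by rewrite -clB.
  by move=> Box; rewrite -[False]/(set0 x) -AB; split.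
- by apply: null_set_setU => //; [have [] := bA|have [] := bB].
Qed.

Lemma Rintegral_setU_overlap (R : realType) (n : nat) (A B : set 'cV[R]_n)
    (f : 'cV[R]_n -> R) :
  compact A -> compact B -> lebesgue_cV (A `&` B) = 0%E -> continuous f ->
  \int[lebesgue_cV]_(x in A `|` B) f x =
  \int[lebesgue_cV]_(x in A) f x + \int[lebesgue_cV]_(x in B) f x.
Proof.
move=> cA cB AB0 cf.
have mA := compact_measurable_cV _ _ _ cA.
have mB := compact_measurable_cV _ _ _ cB.
have iAB : lebesgue_cV.-integrable (A `|` B) (EFin \o f).
  by apply: continuous_compact_integrable_cV => //; exact: compactU.
have iB : lebesgue_cV.-integrable B (EFin \o f).
  exact: continuous_compact_integrable_cV.
have AUB : A `|` B = A `|` (B `\` A).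
  apply/seteqP; split=> x /= [Ax|]; [by left| |by left|by case; right].
  by have [|nAx] := pselect (A x); [left|right].
rewrite {1}AUB Rintegral_setU//.
- congr (_ + _); rewrite /Rintegral; congr fine.
  have -> : B `\` A = B `\` (A `&` B).
    by rewrite setDIr setDv setU0.
  rewrite [RHS](@negligible_integral _ _ _ _ _ (A `&` B))//.
  exact: measurableI.
- exact: measurableD.
- by rewrite -AUB.
- apply/disj_setPS => x [Ax [_ nAx]]; exact: nAx.
Qed.

(** Clears the denominator of [mean]. For a null set the identity survives
    division by zero, because the integral vanishes as well. *)
Lemma volume_mean (R : realType) (n : nat) (A : set 'cV[R]_n)
    (f : 'cV[R]_n -> R) : compact A -> continuous f ->
  volume A * mean A f = \int[lebesgue_cV]_(x in A) f x.
Proof.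
move=> cA cf; have [A0|A0] := eqVneq (volume A) 0; last first.
  by rewrite /mean mulrCA divff ?mulr1.
rewrite A0 mul0r /Rintegral null_set_integral//.
- exact: compact_measurable_cV.
- have := continuous_compact_integrable_cV _ _ _ _ cA cf.
  exact: measurable_int.
- have := A0; rewrite /volume => /eqP; rewrite fine_eq0 => [/eqP//|].
  by rewrite ge0_fin_numE ?measure_ge0 ?compact_lebesgue_cV_fin.
Qed.

(** Recovers the common variance c of an isotropic set from C = 1 / c^n. With
    0^-1 = 0 the identity extends to c = 0, so c may be any value that is
    known to be a variance. *)
Lemma powR_exprVK (R : realType) (n : nat) (c : R) :
  (0 < n)%N -> 0 <= c -> (c ^+ n)^-1 `^ (- n%:R^-1) = c.
Proof.
move=> n0 c0; rewrite -powR_mulrn// -powRN -powRrM mulrNN.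
by rewrite divff ?powRr1// pnatr_eq0 -lt0n.
Qed.

Theorem lemma6p13 (R : realType) (n : nat) (K L C : set 'cV[R]_n)
  (K_convex_body : convex_body K)
  (L_body : compact_body L) (C_body : compact_body C)
  (LK : L `<=` K) (CK : C `<=` K)
  (K_decomp : K = L `|` C) (int_disj : L° `&` C° = set0)
  (L_iso : isotropic L) :
  1 / calC K =
  \det (calC L `^ (- (1 / n%:R)) *: 1%:M + volume C *: Cov C
        + (volume C / volume K) *: (barycenter C *m (barycenter C)^T))
  / volume K ^+ (n + 2).
Proof.
have [cL _ _] := L_body; have [cC _ _] := C_body.
have [cK _ _] := K_convex_body; have [vL bL [c covL]] := L_iso.
have LC0 := compact_body_overlap _ _ _ _ L_body C_body int_disj.
have cont1 i : continuous (fun x : 'cV[R]_n => x i 0).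
  exact: (@coord_continuous R n 1 i 0).
have cont2 i j : continuous (fun x : 'cV[R]_n => x i 0 * x j 0).
  move=> x; exact: continuousM (cont1 i x) (cont1 j x).
have splitK f : continuous f ->
    volume K * mean K f = volume L * mean L f + volume C * mean C f.
  by move=> cf; rewrite !volume_mean// K_decomp Rintegral_setU_overlap.
(* Volumes split like moments: they are integrals of the constant 1. *)
have vol_int A : compact A ->
    volume A = \int[@lebesgue_cV R n]_(x in A) (fun=> 1) x.
  by move=> cA; rewrite Rintegral_cst ?mul1r//; exact: compact_measurable_cV.
have volK : volume K = 1 + volume C.
  rewrite -vL !vol_int// K_decomp Rintegral_setU_overlap//.
  exact: cst_continuous.
have volC0 : 0 <= volume C by exact: fine_ge0.
have volK0 : volume K != 0 by rewrite volK gt_eqF// ltr_pwDl.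
have meanL1 i : mean L (fun x => x i 0) = 0.
  by move/matrixP : bL => /(_ i 0); rewrite !mxE.
have meanL2 i j : mean L (fun x => x i 0 * x j 0) = c *+ (i == j).
  by move/matrixP : covL => /(_ i j); rewrite !mxE !meanL1 mulr0 subr0.
have calCL : calC L `^ (- (1 / n%:R)) *: 1%:M = c%:M :> 'M[R]_n.
  rewrite /calC vL covL det_scalar expr1n !div1r scalemx1.
  (* Entrywise, an index i : 'I_n forces 0 < n; for n = 0 both sides are empty. *)
  apply/matrixP => i j; rewrite !mxE powR_exprVK//.
    exact: leq_ltn_trans (leq0n i) (ltn_ord i).
  have := meanL2 i i; rewrite eqxx mulr1n => <-; rewrite /mean vL divr1.
  by apply: Rintegral_ge0 => x _; rewrite -expr2 sqr_ge0.
have KM : calC L `^ (- (1 / n%:R)) *: 1%:M + volume C *: Cov C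
    + (volume C / volume K) *: (barycenter C *m (barycenter C)^T)
    = volume K *: Cov K.
  rewrite calCL; apply/matrixP => i j.
  have m2 := splitK _ (cont2 i j); rewrite vL mul1r meanL2 in m2.
  have m1 k : mean K (fun x => x k 0) =
      volume C * mean C (fun x => x k 0) / volume K.
    have := splitK _ (cont1 k); rewrite meanL1 mulr0 add0r => <-.
    by rewrite mulrAC divff ?mul1r.
  rewrite !mxE big_ord1 !mxE !mulrBr m2 !m1.
  by move: volK0; rewrite volK => volK0; field.
rewrite KM detZ /calC div1r invf_div exprD -mulf_div.
by rewrite divff ?expf_neq0// mul1r.
Qed.
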